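(* There exist absolute constants $c,C>0$ such that the following holds. Let $\theta\in(-1,0]$, $T>e$, $t=\log\log T$, $t_\theta=|\theta|t$, and $2<x<e^{t(1+\theta)/2}$. Then $$\mathbb{P}\Big\{\max_{|h|\le 2e^{\theta t}}|S_{t_\theta}(h)-S_{t_\theta}(0)|>x\Big\}\le C e^{-x^2/c}.$$
   Context: $\tau$ is a random variable uniformly distributed on $[T,2T]$, and for real $k\le t$, $$S_k(h)=\sum_{\exp(e^{1000})<p\le \exp(e^k)}\mathrm{Re}\Big(\frac{1}{p^{1/2+i(\tau+h)}}+\frac12\,\frac{1}{p^{1+2i(\tau+h)}}\Big)$$ (sum over primes $p$; empty sums are $0$). The maximum is over real $h$. *)

(* Defs.v *)
From HB Require Import structures.
From mathcomp Require Import all_boot all_order all_algebra.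
From mathcomp Require Import complex.
From mathcomp Require Import all_classical all_reals all_analysis.

Set Implicit Arguments.
Unset Strict Implicit.
Unset Printing Implicit Defensive.

Import Order.TTheory GRing.Theory Num.Theory.
Import numFieldNormedType.Exports.

Local Open Scope classical_set_scope.
Local Open Scope ring_scope.
Local Open Scope complex_scope.

Definition cexp (R : realType) (z : R[i]) : R[i] :=
  (expR (complex.Re z))%:C * (cos (complex.Im z) +i* sin (complex.Im z)).

(* [n ^ s = exp (s log n)], for a positive integer [n] *)
Definition natcpow (R : realType) (n : nat) (s : R[i]) : R[i] :=
  cexp (s * (ln (n%:R : R))%:C).

Definition prime_term (R : realType) (p : nat) (y : R) : R :=
  complex.Re ((natcpow p (2^-1 +i* y))^-1
              + 2^-1 * (natcpow p (1 +i* (2 * y)))^-1).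

(* [S_k (h)], the random shift [tau] being an explicit argument; the bound
   [p < (Num.truncn _).+1] is implied by the filter. *)
Definition prime_sum (R : realType) (tau k h : R) : R :=
  \sum_(0 <= p < (Num.truncn (expR (expR k))).+1
        | [&& prime p, expR (expR 1000) < p%:R :> R & p%:R <= expR (expR k)])
    prime_term p (tau + h).

Definition uniform_on d (Omega : measurableType d) (R : realType)
    (P : probability Omega R) (X : {RV P >-> R}) (a b : R) : Prop :=
  exists ab : a < b, forall U : set R, measurable U ->
    distribution P X U = uniform_prob ab U.

(* [max_(|h| <= r) |S_k (h) - S_k (0)|]; the maximum of a continuous function
   over a compact set is its supremum. *)
Definition max_increment (R : realType) (tau k r : R) : \bar R :=
  ereal_sup [set `|prime_sum tau k h - prime_sum tau k 0|%:E
            | h in [set h : R | `|h| <= r]].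

(* Main.v *)
Require Import Defs.
From HB Require Import structures.
From mathcomp Require Import all_boot all_order all_algebra.
From mathcomp Require Import complex.
From mathcomp Require Import all_classical all_reals all_analysis.
From mathcomp Require Import perm measurable_realfun.
From mathcomp Require Import ring lra.

Set Implicit Arguments.
Unset Strict Implicit.
Unset Printing Implicit Defensive.

Import Order.TTheory GRing.Theory Num.Theory.
Import numFieldNormedType.Exports.

Local Open Scope classical_set_scope.
Local Open Scope ring_scope.

(** Write the increment as a difference of values of
    [G s = sum_p (p^(-1/2) cos (s ln p) + p^(-1) / 2 cos (2 s ln p))], and put
    [r = 2 e^(-k)], [Y = exp (e^k)], so that the primes are at most [Y] and
    [x^2 < e^(t - k) = ln T / ln Y].  No chaining over [h] is needed: [G]
    oscillates at scale [e^(-k)], which is comparable to [r], so the supremum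
    over [h] is controlled by the derivative [G'] on a window of radius [r].

    The squares of primes contribute at most [sum_p ln p / p <= 2 e^k] to
    [|G'|] for every value of [tau], hence at most [4] to the increment.  The
    rest of [G'] is bounded by the modulus of [A s = sum_p a_p p^(- i s)], with
    [a_p = p^(-1/2) ln p].  Here [V = sum_p a_p^2 <= 2 e^(2 k)], by the upper
    half of Mertens' theorem ([sum_ln_prime_div]).

    The power [|A|^(2 q)] expands over pairs of words of [q] primes
    ([trig_sum_expr]).  The pairs with equal product number at most [q!] per
    word, by unique factorization ([card_same_prime_product]); the others
    oscillate with frequency at least [Y^(-q)] and their total is absorbed
    as soon as [Y^(2 q) <= T].  A Schur test then gives the mean value
    [(q! + 2) V^q] for [|A|^(2 q)] over [T, 2 T] ([word_mean_value]), as for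
    independent phases.

    For any [M > 0], [|A| <= M + M (|A| / M)^(2 q)].  Integrated over a window
    with [M = x / (4 r)], this shows that an increment larger than [x] forces
    the window integral of [(|A| / M)^(2 q)] to be at least [2 r]
    ([cos_sum_increment_le]), so Markov's inequality bounds the probability
    by [(q! + 2) (V / M^2)^q <= 3 (128 q / x^2)^q].  The choice
    [q = floor (x^2 / 512)] makes this at most [3 e^(-q)], and the hypothesis
    on [x] is what allows [Y^(2 q) <= T].

    All integrals are of trigonometric polynomials, so they are handled
    through explicit primitives: no exchange of integrals is involved, and the
    fundamental theorem of calculus is used only once, for the law of
    [tau]. *)

(** * Primes: unique factorization and a Mertens bound *)

Lemma logn_prod_primes (l : nat) (s : seq nat) :
  all prime s -> logn l (\prod_(p <- s) p)%N = count_mem l s.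
Proof.
elim: s => [|p s IHs] /=; first by rewrite big_nil logn1.
case/andP=> p_pr s_pr; rewrite big_cons lognM ?(prime_gt0 p_pr) //; last first.
  rewrite big_seq; apply: (@prodn_cond_gt0 _ s (mem s) id) => q q_s.
  exact/prime_gt0/(allP s_pr).
by rewrite IHs // logn_prime // eq_sym.
Qed.

Lemma prod_primes_perm_eq (s1 s2 : seq nat) :
  all prime s1 -> all prime s2 ->
  (\prod_(p <- s1) p = \prod_(p <- s2) p)%N -> perm_eq s1 s2.
Proof.
move=> pr1 pr2 eq12; rewrite /perm_eq; apply/allP => l _ /=.
by rewrite -!logn_prod_primes // eq12.
Qed.

(** The diagonal of the moment computation.  By unique factorization a word
    with the same product as [f] is a rearrangement of [f], so the set is
    covered by the image of the symmetric group.  Repeated letters make this an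
    inequality. *)
Lemma card_same_prime_product (I : finType) (p : I -> nat) (q : nat)
    (f : {ffun 'I_q -> I}) :
  injective p -> (forall i, prime (p i)) ->
  (#|[pred g : {ffun 'I_q -> I} | \prod_i p (g i) == \prod_i p (f i)]|
     <= q`!)%N.
Proof.
move=> p_inj p_pr.
pose val_tuple (g : {ffun 'I_q -> I}) := [tuple g i | i < q].
have prodE (g : {ffun 'I_q -> I}) :
    (\prod_i p (g i) = \prod_(n <- map p (val_tuple g)) n)%N.
  by rewrite big_map big_tuple; apply: eq_bigr => i _; rewrite tnth_mktuple.
have all_pr (g : {ffun 'I_q -> I}) : all prime (map p (val_tuple g)).
  by rewrite all_map; apply/allP => i _ /=.
rewrite -card_Sn -cardsT.
apply: leq_trans (leq_imset_card (fun s : 'S_q => [ffun i => f (s i)]) _).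
apply: subset_leq_card; apply/fintype.subsetP => g; rewrite inE => /eqP eq_fg.
have /(perm_map_inj p_inj)/tuple_permP[s gE] :
    perm_eq (map p (val_tuple g)) (map p (val_tuple f)).
  by apply: prod_primes_perm_eq; rewrite -?prodE.
apply/imsetP; exists s; rewrite ?inE //; apply/ffunP => i.
have /(congr1 (fun t => tnth t i)) := val_inj gE.
by rewrite !tnth_mktuple ffunE.
Qed.

(** In Legendre's formula for the exponent of [p] in [n!], the first term
    [n %/ p] already counts the multiples of [p]. *)
Lemma prod_floor_dvd_fact (n : nat) :
  (\prod_(p <- [seq p <- index_iota 0 n.+1 | prime p]) p ^ (n %/ p) <= n`!)%N.
Proof.
pose small : nat_pred := [pred p | prime p && (p < n.+1)%N].
apply: leq_trans (dvdn_leq (fact_gt0 n) (dvdn_part small n`!)).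
rewrite big_filter (big_nat_widen _ _ n`!.+1) ?ltnS ?fact_geq //.
apply: leq_prod => p /andP[p_pr le_pn].
rewrite leq_pexp2l ?prime_gt0 // logn_fact //.
case: n {small} le_pn => [|n] le_pn; first by rewrite div0n.
by rewrite big_ltn // expn1 leq_addr.
Qed.

Lemma fact_leq_expn (n : nat) : (n`! <= n ^ n)%N.
Proof.
elim: n => // n IHn; rewrite factS expnS leq_mul2l /=.
by apply: leq_trans IHn _; case: n => // n; rewrite leq_exp2r.
Qed.

Lemma ln_prod (R : realType) (I : Type) (s : seq I) (P : pred I) (F : I -> R) :
  (forall i, P i -> 0 < F i) ->
  ln (\prod_(i <- s | P i) F i) = \sum_(i <- s | P i) ln (F i).
Proof.
move=> F_gt0.
suff [] : 0 < \prod_(i <- s | P i) F i /\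
  ln (\prod_(i <- s | P i) F i) = \sum_(i <- s | P i) ln (F i) by [].
elim/big_ind2: _ => [|x u y v [x0 <-] [y0 <-]|i Pi]; rewrite ?ln1 ?ltr01 //.
  by rewrite mulr_gt0 // lnM.
by rewrite F_gt0.
Qed.

(** Mertens' first theorem with a constant factor lost, from the comparison
    of [prod_p p^(n %/ p)] with [n! <= n^n]. *)
Lemma sum_ln_prime_div (R : realType) (n : nat) :
  (0 < n)%N ->
  \sum_(p <- [seq p <- index_iota 0 n.+1 | prime p]) ln (p%:R : R) / p%:R
    <= 2 * ln (n%:R : R).
Proof.
move=> n_gt0; have n_gt0R : (0 : R) < n%:R by rewrite ltr0n.
have lnX (p m : nat) : (0 < p)%N -> ln ((p ^ m)%:R : R) = m%:R * ln (p%:R).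
  by move=> p_gt0; rewrite natrX lnXn ?ltr0n // mulr_natl.
have fact_le : ln (n`!%:R : R) <= n%:R * ln (n%:R : R).
  rewrite -lnX // ler_ln ?posrE ?ltr0n ?fact_gt0 ?expn_gt0 ?n_gt0 // ler_nat.
  exact: fact_leq_expn.
have sum_le : \sum_(0 <= p < n.+1 | prime p) (n %/ p)%:R * ln (p%:R : R)
    <= n%:R * ln (n%:R : R).
  apply: le_trans fact_le.
  have -> : \sum_(0 <= p < n.+1 | prime p) (n %/ p)%:R * ln (p%:R : R)
      = ln (\prod_(0 <= p < n.+1 | prime p) (p ^ (n %/ p))%:R).
    rewrite ln_prod => [|p /prime_gt0 p_gt0]; last first.
      by rewrite ltr0n expn_gt0 p_gt0.
    by apply: eq_bigr => p /prime_gt0 p_gt0; rewrite lnX.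
  rewrite -natr_prod ler_ln ?posrE ?ltr0n ?fact_gt0 //; last first.
    by apply: prodn_cond_gt0 => p /prime_gt0 p_gt0; rewrite expn_gt0 p_gt0.
  by rewrite ler_nat -big_filter prod_floor_dvd_fact.
rewrite big_filter -(ler_pM2l n_gt0R) mulrCA.
rewrite (le_trans _ (ler_wpM2l _ sum_le)) ?ler0n //.
rewrite !mulr_sumr big_nat_cond [leRHS]big_nat_cond.
apply: ler_sum => p /andP[/andP[_ le_pn] p_pr].
have p_gt0 := prime_gt0 p_pr.
have ln_ge0 : 0 <= ln (p%:R : R) by rewrite ln_ge0 // ler1n.
rewrite mulrCA mulrC mulrA ler_wpM2r // ler_pdivrMr ?ltr0n //.
rewrite -!natrM ler_nat.
(* [n / p <= 2 (n %/ p)], because the quotient is at least [1] *)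
have lt_n := ltn_ceil n p_gt0; have q_gt0 : (0 < n %/ p)%N by rewrite divn_gt0.
apply: ltnW; apply: leq_trans lt_n _.
by rewrite leq_mul2r mul2n -addnn -addn1 leq_add2l q_gt0 orbT.
Qed.

(** * Primitives of cosines *)

Lemma nondecreasing_is_derive (R : realType) (f df : R -> R) (a b : R) :
  (forall v : R, is_derive v 1 f (df v)) -> (forall v, 0 <= df v) ->
  a <= b -> f a <= f b.
Proof.
move=> f_df df_ge0 le_ab.
have f_drv (v : R) : derivable f v 1 by exact: ex_derive.
have := @ger0_derive1_le_cc _ f a b; apply; rewrite ?in_itv /= ?lexx ?le_ab //.
- by move=> v _; rewrite derive1E derive_val.
- exact: derivable_within_continuous.
Qed.

Lemma is_derive_fsum (R : realType) (I : finType) (F : I -> R -> R)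
    (dF : I -> R) (v : R) :
  (forall i, is_derive v 1 (F i) (dF i)) ->
  is_derive v 1 (fun u => \sum_i F i u) (\sum_i dF i).
Proof.
move=> F_dF; rewrite -fct_sumE; elim/big_ind2: _ => // *.
- exact: is_derive_cst.
- exact: is_deriveD.
Qed.

Lemma is_derive_affine (R : realType) (l c v : R) :
  is_derive v 1 (fun u => l * u + c) l.
Proof.
have -> : (fun u => l * u + c) = l \*: (id : R -> R) + cst c by [].
apply: is_derive_eq; by rewrite addr0 /GRing.scale /= mulr1.
Qed.

(** The primitive of [cos (l * _)] vanishing at [0], written so that it also
    covers the zero frequency. *)
Definition cos_primitive (R : realType) (l v : R) : R :=
  if l == 0 then v else sin (l * v) / l.

Lemma is_derive_cos_primitive (R : realType) (l v : R) :
  is_derive v 1 (cos_primitive l) (cos (l * v)).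
Proof.
rewrite /cos_primitive; case: eqVneq => [->|l_neq0].
  by rewrite mul0r cos0; exact: is_derive_id.
have -> : (fun v => sin (l * v) / l) = l^-1 \*: (sin \o (fun u => l * u + 0)).
  by apply/funext => u /=; rewrite addr0 mulrC.
have dsin := is_derive_sin (l * v + 0).
have daff := is_derive_affine l 0 v.
have dcomp := @is_derive1_comp _ sin (fun u => l * u + 0) v _ _ dsin daff.
apply: is_derive_eq; rewrite addr0 /GRing.scale /= mulrCA mulVf // mulr1 //.
Qed.

(** Averaging over a window of radius [r] acts on each frequency as a
    multiplier, of size at most [2 r].  This is why the window costs nothing in
    the mean value estimate. *)
Lemma cos_primitive_window (R : realType) (l r v : R) :
  cos_primitive l (v + r) - cos_primitive l (v - r)
  = 2 * cos_primitive l r * cos (l * v).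
Proof.
rewrite /cos_primitive; case: eqVneq => [->|l_neq0].
  by rewrite mul0r cos0; ring.
rewrite mulrDr mulrBr sinD sinB; by field.
Qed.

Lemma norm_cos_primitive_sub (R : realType) (l a b : R) :
  a <= b -> `|cos_primitive l b - cos_primitive l a| <= b - a.
Proof.
move=> le_ab.
have mono (s : R) : (s = 1 \/ s = -1) ->
    s * cos_primitive l b - s * cos_primitive l a <= b - a.
  move=> s_sign.
  suff : a - s * cos_primitive l a <= b - s * cos_primitive l b by lra.
  apply: (@nondecreasing_is_derive _ (fun v => v - s * cos_primitive l v)
    (fun v => 1 - s * cos (l * v))) => // v.
    have := is_derive_cos_primitive l v => dprim.
    have -> : (fun v => v - s * cos_primitive l v)
      = (id : R -> R) - s \*: cos_primitive l by [].
    by apply: is_derive_eq.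
  by have := cos_le1 (l * v); have := cos_geN1 (l * v); case: s_sign => ->; lra.
rewrite ler_norml; have := mono 1 (or_introl erefl).
by have := mono (-1) (or_intror erefl); lra.
Qed.

Lemma norm_cos_primitive_sub_inv (R : realType) (l a b : R) :
  l != 0 -> `|cos_primitive l b - cos_primitive l a| <= 2 / `|l|.
Proof.
move=> l_neq0; rewrite /cos_primitive (negPf l_neq0) -mulrBl normrM normfV.
rewrite ler_wpM2r ?invr_ge0 //; apply: le_trans (ler_normB _ _) _.
by have := sin_max (l * b); have := sin_max (l * a); lra.
Qed.

Lemma norm_cos_primitive_le (R : realType) (l r : R) :
  0 <= r -> `|cos_primitive l r| <= r.
Proof.
move=> r_ge0; have := norm_cos_primitive_sub l r_ge0.
have -> : cos_primitive l 0 = 0.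
  by rewrite /cos_primitive mulr0 sin0 mul0r if_same.
by rewrite !subr0.
Qed.

(** * Expansion of powers of trigonometric sums over words *)

Lemma sum_cos_sq_sum_sin_sq (R : realType) (J : finType) (c phi : J -> R) :
  (\sum_j c j * cos (phi j)) ^+ 2 + (\sum_j c j * sin (phi j)) ^+ 2
  = \sum_j \sum_k c j * c k * cos (phi j - phi k).
Proof.
rewrite !expr2 !mulr_suml -big_split; apply: eq_bigr => j _ /=.
rewrite !mulr_sumr -big_split; apply: eq_bigr => k _ /=.
by rewrite cosB; ring.
Qed.

(** Words of length [q] over [I] index the terms of the [q]-th power of a sum
    over [I]. *)
Definition word_coef (R : realType) (I : finType) (a : I -> R) (q : nat)
  (f : {ffun 'I_q -> I}) : R := \prod_i a (f i).

Definition word_freq (R : realType) (I : finType) (w : I -> R) (q : nat)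
  (f : {ffun 'I_q -> I}) : R := \sum_i w (f i).

(** The left-hand side is [|A|^(2 q)] for [A = sum_i a_i e^(i w_i v)]: expand
    the power [A^q] over words, then take the squared modulus. *)
Lemma trig_sum_expr (R : realType) (I : finType) (a w : I -> R) (q : nat)
    (v : R) :
  ((\sum_i a i * cos (w i * v)) ^+ 2 + (\sum_i a i * sin (w i * v)) ^+ 2) ^+ q
  = \sum_(f : {ffun 'I_q -> I}) \sum_(g : {ffun 'I_q -> I})
      word_coef a f * word_coef a g
      * cos ((word_freq w f - word_freq w g) * v).
Proof.
pose e (c x : R) : R[i] := ((c * cos x) +i* (c * sin x))%C.
pose nsq (z : R[i]) : R := complex.Re z ^+ 2 + complex.Im z ^+ 2.
have eM c x d y : e c x * e d y = e (c * d) (x + y).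
  apply/eqP; rewrite eq_complex /= cosD sinD.
  by apply/andP; split; apply/eqP; ring.
have nsqM z z' : nsq (z * z') = nsq z * nsq z'.
  by case: z => x y; case: z' => x' y'; rewrite /nsq /=; ring.
have nsqX z n : nsq (z ^+ n) = nsq z ^+ n.
  elim: n => [|n IHn]; first by rewrite !expr0 /nsq /= expr1n expr0n addr0.
  by rewrite !exprS nsqM IHn.
have sum_e (J : finType) (c x : J -> R) :
    \sum_j e (c j) (x j)
    = ((\sum_j c j * cos (x j)) +i* (\sum_j c j * sin (x j)))%C.
  by elim/big_ind3: _ => // z s u z' s' u' -> ->.
have -> : (\sum_i a i * cos (w i * v)) ^+ 2 + (\sum_i a i * sin (w i * v)) ^+ 2
    = nsq (\sum_i e (a i) (w i * v)) by rewrite sum_e.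
rewrite -nsqX.
have -> : (\sum_i e (a i) (w i * v)) ^+ q
    = \sum_(f : {ffun 'I_q -> I}) e (word_coef a f) (word_freq w f * v).
  rewrite -[in LHS](card_ord q) -prodr_const bigA_distr_bigA /=.
  apply: eq_bigr => f _; rewrite /word_coef /word_freq mulr_suml.
  elim/big_ind3: _ => // [|c z x d z' y -> ->]; last by rewrite eM.
  by rewrite /e cos0 sin0 mulr0 mulr1.
rewrite sum_e /nsq /= sum_cos_sq_sum_sin_sq; apply: eq_bigr => f _.
by apply: eq_bigr => g _; rewrite mulrBl.
Qed.

Lemma sum_word_coef_sq (R : realType) (I : finType) (a : I -> R) (q : nat) :
  \sum_(f : {ffun 'I_q -> I}) word_coef a f ^+ 2 = (\sum_i a i ^+ 2) ^+ q.
Proof.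
rewrite -[in RHS](card_ord q) -prodr_const bigA_distr_bigA /=.
by apply: eq_bigr => f _; rewrite prodrXl.
Qed.

(** [2 c_i c_j <= c_i^2 + c_j^2], and both halves are row sums. *)
Lemma schur_test (R : realType) (J : finType) (c : J -> R) (k : J -> J -> R)
    (K : R) :
  (forall i j, k i j = k j i) -> (forall i j, 0 <= k i j) ->
  (forall i, \sum_j k i j <= K) ->
  \sum_i \sum_j c i * c j * k i j <= K * \sum_i c i ^+ 2.
Proof.
move=> k_sym k_ge0 k_row.
have halves : \sum_i \sum_j c i * c j * k i j
    <= 2^-1 * (\sum_i \sum_j c i ^+ 2 * k i j)
       + 2^-1 * (\sum_i \sum_j c j ^+ 2 * k i j).
  rewrite !mulr_sumr -big_split; apply: ler_sum => i _ /=.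
  rewrite !mulr_sumr -big_split; apply: ler_sum => j _ /=.
  by have := mulr_ge0 (sqr_ge0 (c i - c j)) (k_ge0 i j); nra.
have swap : \sum_i \sum_j c j ^+ 2 * k i j = \sum_i \sum_j c i ^+ 2 * k i j.
  rewrite exchange_big; apply: eq_bigr => i _.
  by apply: eq_bigr => j _; rewrite k_sym.
apply: le_trans halves _; rewrite swap -mulrDl.
have -> : 2^-1 + 2^-1 = 1 :> R by lra.
rewrite mul1r mulr_sumr; apply: ler_sum => i _.
by rewrite -mulr_sumr mulrC ler_wpM2r ?sqr_ge0.
Qed.

(** For [n < m], [ln (m / n) >= 1 - n / m = (m - n) / m >= 1 / m]. *)
Lemma ln_nat_separated (R : realType) (m n : nat) (B : R) :
  (0 < m)%N -> (0 < n)%N -> m != n -> m%:R <= B -> n%:R <= B ->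
  B^-1 <= `|ln (m%:R : R) - ln (n%:R : R)|.
Proof.
wlog lt_nm : m n / (n < m)%N.
  move=> base m0 n0 mn mB nB; have := mn; rewrite neq_ltn => /orP[lt|lt].
    by rewrite distrC; apply: base => //; rewrite eq_sym.
  exact: base.
move=> m_gt0 n_gt0 _ le_mB _; apply: le_trans (ler_norm _).
have m0 : (0 : R) < m%:R by rewrite ltr0n.
have n0 : (0 : R) < n%:R by rewrite ltr0n.
have /le_ln1Dx : -1 < n%:R / m%:R - 1 :> R.
  by have : 0 < n%:R / m%:R :> R; [rewrite divr_gt0 | lra].
rewrite addrCA subrr addr0 ln_div ?posrE // => ln_le.
have le_mV : B^-1 <= m%:R^-1 :> R by rewrite lef_pV2 ?posrE // (lt_le_trans m0).
suff : m%:R^-1 <= 1 - n%:R / m%:R :> R by lra.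
rewrite -[X in X - _](divff (lt0r_neq0 m0)) -mulrBl -[leLHS]mul1r.
by rewrite ler_wpM2r ?invr_ge0 ?ler0n // -natrB ?(ltnW lt_nm) // ler1n subn_gt0.
Qed.

(** * Mean values over [T, 2 T] *)

Lemma cos_primitiveN (R : realType) (l v : R) :
  cos_primitive (- l) v = cos_primitive l v.
Proof.
by rewrite /cos_primitive oppr_eq0 mulNr sinN invrN mulrNN.
Qed.

Lemma word_freq_ln (R : realType) (I : finType) (p : I -> nat) (q : nat)
    (f : {ffun 'I_q -> I}) :
  (forall i, 0 < p i)%N ->
  word_freq (fun i => ln ((p i)%:R : R)) f = ln ((\prod_i p (f i))%N%:R).
Proof.
by move=> p_gt0; rewrite natr_prod ln_prod // => i _; rewrite ltr0n.
Qed.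

(** Schur test with the kernel given by the integrals over [T, 2 T]: in each
    row, at most [q!] entries have frequency zero and contribute [T] each, while
    the at most [Y^q] others contribute at most [2 Y^q] each, for a total of at
    most [2 Y^(2 q) <= 2 T]. *)
Lemma word_mean_value (R : realType) (I : finType) (p : I -> nat) (a : I -> R)
    (q : nat) (Y T : R) :
  injective p -> (forall i, prime (p i)) ->
  0 < Y -> (forall i, (p i)%:R <= Y) -> #|I|%:R <= Y ->
  0 <= T -> Y ^+ (2 * q) <= T ->
  \sum_(f : {ffun 'I_q -> I}) \sum_(g : {ffun 'I_q -> I})
     word_coef a f * word_coef a g
     * (let l := word_freq (fun i => ln (p i)%:R) f
                 - word_freq (fun i => ln (p i)%:R) g in
        `|cos_primitive l (2 * T) - cos_primitive l T|)
  <= (T * (q`!%:R + 2)) * (\sum_i a i ^+ 2) ^+ q.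
Proof.
move=> p_inj p_pr Y_gt0 le_pY le_IY T_ge0 le_YT; rewrite -sum_word_coef_sq.
have p_gt0 i : (0 < p i)%N by exact: prime_gt0.
pose m (f : {ffun 'I_q -> I}) := (\prod_i p (f i))%N.
have m_gt0 f : (0 < m f)%N by apply: prodn_gt0.
have le_mY f : (m f)%:R <= Y ^+ q.
  rewrite natr_prod -[in leRHS](card_ord q) -prodr_const.
  by apply: ler_prod => i _; rewrite ler0n le_pY.
apply: schur_test => [f g|f g|f] /=.
- by rewrite -[_ - word_freq _ f]opprB !cos_primitiveN.
- exact: normr_ge0.
rewrite (bigID (fun g => m g == m f)) /= mulrDr; apply: lerD.
  apply: le_trans (_ : \sum_(g | m g == m f) T <= _).
    apply: ler_sum => g _; apply: le_trans (norm_cos_primitive_sub _ _) _; lra.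
  rewrite sumr_const -[leLHS]mulr_natr ler_wpM2l // ler_nat.
  exact: card_same_prime_product.
apply: le_trans (_ : \sum_(g : {ffun 'I_q -> I}) 2 * Y ^+ q <= _).
  rewrite [leRHS](bigID (fun g => m g == m f)) /=.
  apply: ler_wpDl.
    by apply: sumr_ge0 => g _; rewrite mulr_ge0 // exprn_ge0 // ltW.
  apply: ler_sum => g neq_mgf.
  rewrite !word_freq_ln // -/(m f) -/(m g).
  have sep := ln_nat_separated (m_gt0 f) (m_gt0 g) _ (le_mY f) (le_mY g).
  have {}sep := sep (contra_neq (@esym _ _ _) neq_mgf).
  have YqV_gt0 : 0 < (Y ^+ q)^-1 by rewrite invr_gt0 exprn_gt0.
  apply: le_trans (norm_cos_primitive_sub_inv _ _ _) _.
    by rewrite -normr_gt0 (lt_le_trans YqV_gt0).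
  rewrite ler_wpM2l // -[leRHS]invrK lef_pV2 ?posrE //.
  exact: lt_le_trans sep.
rewrite sumr_const card_ffun card_ord -[leLHS]mulr_natr natrX.
apply: le_trans (_ : 2 * Y ^+ (2 * q) <= _); last by rewrite mulrC ler_wpM2r.
rewrite mul2n -addnn exprD mulrA ler_wpM2l ?mulr_ge0 ?exprn_ge0 ?(ltW Y_gt0) //.
by rewrite lerXn2r ?nnegrE ?ler0n ?(ltW Y_gt0).
Qed.

(** * From the derivative to increments *)

(** If [|z| > M] then [|z| / M <= (|z| / M)^(2 q)].  This substitute for the
    Hoelder inequality keeps the window integrals linear in the moment, so that
    they can be computed term by term. *)
Lemma le_linear_add_pow (R : realType) (M z y : R) (q : nat) :
  (0 < q)%N -> 0 < M -> z ^+ 2 <= y ->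
  `|z| <= M + M * (M^-1) ^+ (2 * q) * y ^+ q.
Proof.
move=> q_gt0 M_gt0 le_zy; pose t := `|z| / M.
have t_ge0 : 0 <= t by rewrite divr_ge0 // ltW.
have zE : `|z| = M * t by rewrite mulrCA divff ?mulr1 // lt0r_neq0.
have pow_le : t ^+ (2 * q) <= (M^-1) ^+ (2 * q) * y ^+ q.
  rewrite exprMn mulrC ler_wpM2l ?exprn_ge0 ?invr_ge0 ?(ltW M_gt0) //.
  rewrite exprM real_normK ?num_real // lerXn2r ?nnegrE ?sqr_ge0 //.
  exact: le_trans (sqr_ge0 z) le_zy.
have t_le : t <= 1 + t ^+ (2 * q).
  have [t_le1|t_gt1] := leP t 1.
    by apply: le_trans t_le1 _; rewrite lerDl exprn_ge0.
  rewrite -[leLHS]expr1 ler_wpDl // ler_weXn2l ?(ltW t_gt1) //.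
  by rewrite muln_gt0.
rewrite -mulrA -[X in X + _]mulr1 -mulrDr zE ler_wpM2l ?(ltW M_gt0) //.
exact: le_trans t_le (lerD (lexx _) pow_le).
Qed.

(** The integral over the window [s - r, s + r] of [|A|^(2 q)], in closed
    form. *)
Definition word_window (R : realType) (I : finType) (a w : I -> R) (q : nat)
    (r s : R) : R :=
  \sum_(f : {ffun 'I_q -> I}) \sum_(g : {ffun 'I_q -> I})
    word_coef a f * word_coef a g
    * (2 * cos_primitive (word_freq w f - word_freq w g) r
       * cos ((word_freq w f - word_freq w g) * s)).

Definition word_primitive (R : realType) (I : finType) (a w : I -> R) (q : nat)
    (v : R) : R :=
  \sum_(f : {ffun 'I_q -> I}) \sum_(g : {ffun 'I_q -> I})
    word_coef a f * word_coef a g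
    * cos_primitive (word_freq w f - word_freq w g) v.

Lemma is_derive_scale_cos_primitive (R : realType) (c l v : R) :
  is_derive v 1 (fun u => c * cos_primitive l u) (c * cos (l * v)).
Proof.
have dprim := is_derive_cos_primitive l v.
have -> : (fun u => c * cos_primitive l u) = c \*: cos_primitive l by [].
exact: is_deriveZ.
Qed.

Lemma is_derive_word_primitive (R : realType) (I : finType) (a w : I -> R)
    (q : nat) (v : R) :
  is_derive v 1 (word_primitive a w q)
    (((\sum_i a i * cos (w i * v)) ^+ 2
      + (\sum_i a i * sin (w i * v)) ^+ 2) ^+ q).
Proof.
rewrite trig_sum_expr; apply: is_derive_fsum => f; apply: is_derive_fsum => g.
exact: is_derive_scale_cos_primitive.
Qed.

Lemma word_window_primitive (R : realType) (I : finType) (a w : I -> R)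
    (q : nat) (r s : R) :
  word_window a w q r s
  = word_primitive a w q (s + r) - word_primitive a w q (s - r).
Proof.
rewrite -sumrB; apply: eq_bigr => f _; rewrite -sumrB; apply: eq_bigr => g _.
by rewrite -mulrBr cos_primitive_window.
Qed.

Lemma word_primitive_le (R : realType) (I : finType) (a w : I -> R) (q : nat)
    (u v : R) :
  u <= v -> word_primitive a w q u <= word_primitive a w q v.
Proof.
apply: nondecreasing_is_derive; first exact: is_derive_word_primitive.
by move=> x; rewrite exprn_ge0 // addr_ge0 // sqr_ge0.
Qed.

Lemma word_window_ge0 (R : realType) (I : finType) (a w : I -> R) (q : nat)
    (r s : R) :
  0 <= r -> 0 <= word_window a w q r s.
Proof.
move=> r_ge0; rewrite word_window_primitive subr_ge0.
by apply: word_primitive_le; lra.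
Qed.

(** The coefficients [d] are carried by the doubled frequencies, as for the
    squares of the primes. *)
Definition cos_sum (R : realType) (I : finType) (b d w : I -> R) (v : R) : R :=
  \sum_i (b i * cos (w i * v) + d i * cos (2 * w i * v)).

Lemma is_derive_cos_affine (R : realType) (c l v : R) :
  is_derive v 1 (fun u => c * cos (l * u)) (- (c * l * sin (l * v))).
Proof.
have -> : (fun u => c * cos (l * u)) = c \*: (cos \o (fun u => l * u + 0)).
  by apply/funext => u /=; rewrite addr0.
have dcos := is_derive_cos (l * v + 0).
have daff := is_derive_affine l 0 v.
have dcomp := @is_derive1_comp _ cos (fun u => l * u + 0) v _ _ dcos daff.
by apply: is_derive_eq; rewrite addr0 /GRing.scale /=; ring.
Qed.

Lemma is_derive_cos_sum (R : realType) (I : finType) (b d w : I -> R) (v : R) :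
  is_derive v 1 (cos_sum b d w)
    (- (\sum_i b i * w i * sin (w i * v)
        + \sum_i 2 * d i * w i * sin (2 * w i * v))).
Proof.
rewrite -big_split -sumrN; apply: is_derive_fsum => i.
have d1 := is_derive_cos_affine (b i) (w i) v.
have d2 := is_derive_cos_affine (d i) (2 * w i) v.
have -> : (fun u => b i * cos (w i * u) + d i * cos (2 * w i * u))
  = (fun u => b i * cos (w i * u)) + (fun u => d i * cos (2 * w i * u)) by [].
by apply: is_derive_eq; rewrite opprD; congr (- _ - _); ring.
Qed.

(** The function [E z = (L + M) z + c B z], where [B] is a primitive of
    [|A|^(2 q)] and [c = M (1 / M)^(2 q)], has a derivative that dominates that
    of the cosine sum in absolute value, so increments of [E] dominate those of
    the sum; and since [B] is nondecreasing, its increment between [s] and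
    [s + h] is at most the one over the whole window. *)
Lemma cos_sum_increment_le (R : realType) (I : finType) (b d w : I -> R)
    (q : nat) (L M r s h : R) :
  (0 < q)%N -> 0 < M -> \sum_i `|2 * d i * w i| <= L -> `|h| <= r ->
  `|cos_sum b d w (s + h) - cos_sum b d w s|
  <= (L + M) * r
     + M * (M^-1) ^+ (2 * q) * word_window (fun i => b i * w i) w q r s.
Proof.
move=> q_gt0 M_gt0 le_L le_hr.
set c := M * _; pose a i := b i * w i; pose B := word_primitive a w q.
have c_ge0 : 0 <= c by rewrite mulr_ge0 ?exprn_ge0 ?invr_ge0 ?(ltW M_gt0).
have L_ge0 : 0 <= L by apply: le_trans le_L; apply: sumr_ge0.
have incr u v : u <= v -> `|cos_sum b d w v - cos_sum b d w u|
    <= (L + M) * (v - u) + c * (B v - B u).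
  move=> le_uv; have mono (e : R) : (e = 1 \/ e = -1) ->
    e * cos_sum b d w v - e * cos_sum b d w u
      <= (L + M) * (v - u) + c * (B v - B u).
    move=> e_sign.
    suff : (L + M) * u + c * B u - e * cos_sum b d w u
        <= (L + M) * v + c * B v - e * cos_sum b d w v by lra.
    pose dG z := - (\sum_i b i * w i * sin (w i * z)
        + \sum_i 2 * d i * w i * sin (2 * w i * z)).
    pose H z := ((\sum_i a i * cos (w i * z)) ^+ 2
      + (\sum_i a i * sin (w i * z)) ^+ 2) ^+ q.
    apply: (@nondecreasing_is_derive _
      (fun z => (L + M) * z + c * B z - e * cos_sum b d w z)
      (fun z => (L + M) + c * H z - e * dG z)) => // z.
      have dcs := is_derive_cos_sum b d w z.
      have dB := is_derive_word_primitive a w q z.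
      have -> : (fun z => (L + M) * z + c * B z - e * cos_sum b d w z)
        = ((L + M) \*: (id : R -> R) + c \*: B - e \*: cos_sum b d w) by [].
      by apply: is_derive_eq; rewrite /GRing.scale /= mulr1.
    have : `|\sum_i 2 * d i * w i * sin (2 * w i * z)| <= L.
      apply: le_trans le_L; apply: le_trans (ler_norm_sum _ _ _) _.
      apply: ler_sum => i _; rewrite normrM -[leRHS]mulr1.
      by rewrite ler_wpM2l // sin_max.
    have : `|\sum_i b i * w i * sin (w i * z)| <= M + c * H z.
      by apply: le_linear_add_pow => //; rewrite lerDr sqr_ge0.
    rewrite /dG; case: e_sign => ->; rewrite !ler_norml; lra.
  rewrite ler_norml; have := mono 1 (or_introl erefl).
  by have := mono (-1) (or_intror erefl); lra.
rewrite word_window_primitive -/a -/B.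
move: le_hr; rewrite ler_norml => /andP[hN hr].
have r_ge0 : 0 <= r by lra.
have mono_B u v : u <= v -> c * B u <= c * B v.
  by move=> le_uv; rewrite ler_wpM2l // word_primitive_le.
have LM_ge0 : 0 <= L + M by rewrite addr_ge0 // ltW.
have [h_ge0|h_lt0] := leP 0 h.
  have le1 : s <= s + h by lra.
  have le2 : c * B (s + h) <= c * B (s + r) by apply: mono_B; lra.
  have le3 : c * B (s - r) <= c * B s by apply: mono_B; lra.
  have le4 : (L + M) * h <= (L + M) * r by rewrite ler_wpM2l.
  by have := incr _ _ le1; rewrite addrAC subrr add0r; lra.
have le1 : s + h <= s by lra.
have le2 : c * B (s - r) <= c * B (s + h) by apply: mono_B; lra.
have le3 : c * B s <= c * B (s + r) by apply: mono_B; lra.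
have le4 : (L + M) * (- h) <= (L + M) * r by rewrite ler_wpM2l // lerNl.
have subE : s - (s + h) = - h by lra.
by rewrite distrC; have := incr _ _ le1; rewrite subE; lra.
Qed.

(** * Markov inequality for a uniform law *)

Lemma continuous_is_derive (R : realType) (f df : R -> R) :
  (forall v : R, is_derive v 1 f (df v)) -> continuous f.
Proof.
move=> f_df v; apply/differentiable_continuous/derivable1_diffP.
exact: ex_derive.
Qed.

(** Markov's inequality, with the expectation of [f] evaluated through its
    primitive [F]. *)
Lemma uniform_prob_le_primitive (R : realType) (a b : R) (ab : a < b)
    (f F : R -> R) (U : set R) :
  measurable U -> continuous f -> (forall v, 0 <= f v) ->
  (forall v : R, is_derive v 1 F (f v)) -> (forall v, U v -> 1 <= f v) ->
  (uniform_prob ab U <= ((F b - F a) / (b - a))%:E)%E.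
Proof.
move=> mU f_cont f_ge0 dF f_ge1.
have ba_gt0 : 0 < b - a by rewrite subr_gt0.
have baV_ge0 : 0 <= (b - a)^-1 by rewrite invr_ge0 ltW.
pose g v := (b - a)^-1 * f v; pose G v := (b - a)^-1 * F v.
have dG (v : R) : is_derive v 1 G (g v).
  have -> : G = (b - a)^-1 \*: F by [].
  exact: is_deriveZ.
have g_cont : continuous g.
  by move=> v; apply: cvgM; [exact: cvg_cst | exact: f_cont].
have G_cont := continuous_is_derive dG.
have g_ge0 v : 0 <= g v by rewrite mulr_ge0.
have g_meas := continuous_measurable_fun g_cont.
have mUab : measurable (U `&` `[a, b]) by exact: measurableI.
rewrite /uniform_prob integral_uniform_pdf.
apply: (@le_trans _ _ (\int[lebesgue_measure]_(v in U `&` `[a, b]) (g v)%:E)%E).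
  apply: ge0_le_integral => //=.
  - by move=> v _; rewrite lee_fin uniform_pdf_ge0.
  - by apply/measurable_EFinP/measurable_funTS; exact: measurable_uniform_pdf.
  - by apply/measurable_EFinP/measurable_funTS.
  - move=> v [Uv]; rewrite in_itv/= /uniform_pdf => ->.
    by rewrite lee_fin -[leLHS]mulr1 ler_wpM2l // f_ge1.
apply: (@le_trans _ _ (\int[lebesgue_measure]_(v in `[a, b]) (g v)%:E)%E).
  apply: ge0_subset_integral => //=.
  - by apply/measurable_EFinP/measurable_funTS.
  - by move=> v _; rewrite lee_fin.
rewrite (@continuous_FTC2 _ g G) //.
- by rewrite -EFinB lee_fin /G -mulrBr mulrC.
- exact: continuous_subspaceT.
- split=> [v _||]; first exact: ex_derive.
  + exact/cvg_at_right_filter/G_cont.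
  + exact/cvg_at_left_filter/G_cont.
- by move=> v _; rewrite derive1E derive_val.
Qed.

(** * Large increments of a cosine sum *)

Definition word_window_antiderivative (R : realType) (I : finType) (a w : I -> R)
    (q : nat) (r v : R) : R :=
  \sum_(f : {ffun 'I_q -> I}) \sum_(g : {ffun 'I_q -> I})
    word_coef a f * word_coef a g
    * (2 * cos_primitive (word_freq w f - word_freq w g) r
       * cos_primitive (word_freq w f - word_freq w g) v).

Lemma is_derive_word_window_antiderivative (R : realType) (I : finType)
    (a w : I -> R) (q : nat) (r v : R) :
  is_derive v 1 (word_window_antiderivative a w q r) (word_window a w q r v).
Proof.
apply: is_derive_fsum => f; apply: is_derive_fsum => g; rewrite mulrA.
set c := _ * (2 * _).
have -> : (fun u => word_coef a f * word_coef a g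
      * (2 * cos_primitive (word_freq w f - word_freq w g) r
         * cos_primitive (word_freq w f - word_freq w g) u))
    = (fun u => c * cos_primitive (word_freq w f - word_freq w g) u).
  by apply/funext => u; rewrite mulrA.
exact: is_derive_scale_cos_primitive.
Qed.

Lemma word_window_mean_value (R : realType) (I : finType) (p : I -> nat)
    (a : I -> R) (q : nat) (Y T r : R) :
  injective p -> (forall i, prime (p i)) -> (forall i, 0 <= a i) ->
  0 < Y -> (forall i, (p i)%:R <= Y) -> #|I|%:R <= Y ->
  0 <= T -> Y ^+ (2 * q) <= T -> 0 <= r ->
  let W := word_window_antiderivative a (fun i => ln (p i)%:R) q r in
  W (2 * T) - W T <= 2 * r * ((T * (q`!%:R + 2)) * (\sum_i a i ^+ 2) ^+ q).
Proof.
move=> p_inj p_pr a_ge0 Y_gt0 le_pY le_IY T_ge0 le_YT r_ge0 /=.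
have := word_mean_value a p_inj p_pr Y_gt0 le_pY le_IY T_ge0 le_YT.
move=> /(ler_wpM2l (_ : 0 <= 2 * r)) => /(_ (mulr_ge0 (ler0n _ 2) r_ge0)).
apply: le_trans; rewrite mulr_sumr -sumrB; apply: ler_sum => f _.
rewrite mulr_sumr -sumrB; apply: ler_sum => g _ /=; set l := word_freq _ f - _.
have coef_ge0 : 0 <= word_coef a f * word_coef a g.
  by rewrite mulr_ge0 // prodr_ge0.
rewrite -mulrBr [leRHS]mulrCA ler_wpM2l // -mulrBr.
apply: le_trans (ler_norm _) _; rewrite !normrM ler_wpM2r //.
by rewrite (ger0_norm (ler0n _ 2)) ler_wpM2l // norm_cos_primitive_le.
Qed.

Lemma continuous_cos_sum (R : realType) (I : finType) (b d w : I -> R) :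
  continuous (cos_sum b d w).
Proof. exact: continuous_is_derive (is_derive_cos_sum b d w). Qed.

Definition big_increment (R : realType) (G : R -> R) (r x : R) : set R :=
  [set s | exists2 h, `|h| <= r & x < `|G (s + h) - G s|].

(** A union over [h] of open sets; this gives the measurability of an event
    defined by an uncountable supremum. *)
Lemma open_big_increment (R : realType) (G : R -> R) (r x : R) :
  continuous G -> open (big_increment G r x).
Proof.
move=> G_cont.
have -> : big_increment G r x
    = \bigcup_(h in [set h | `|h| <= r])
        ((fun s => `|G (s + h) - G s|) @^-1` [set y | x < y]).
  by apply/seteqP; split=> s; case=> h hr xG; exists h.
apply: bigcup_open => h _; apply: open_comp; last exact: open_gt.
move=> s _; apply: (@continuous_comp _ _ _ (fun s => G (s + h) - G s) Num.norm);
  last exact: norm_continuous.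
apply: cvgB; last exact: G_cont.
apply: (@continuous_comp _ _ _ (fun s => s + h) G); last exact: G_cont.
by apply: cvgD; [exact: cvg_id | exact: cvg_cst].
Qed.

(** The threshold [x] is split: [(L + M) r] is consumed by the deterministic
    part of the increment, so the window integral has to account for [y]. *)
Lemma uniform_prob_big_increment (R : realType) (I : finType) (p : I -> nat)
    (b d : I -> R) (q : nat) (Y T L M r x y : R) (TT : T < 2 * T) :
  let w i : R := ln (p i)%:R in
  injective p -> (forall i, prime (p i)) -> (forall i, 0 <= b i) ->
  0 < Y -> (forall i, (p i)%:R <= Y) -> #|I|%:R <= Y ->
  Y ^+ (2 * q) <= T -> 0 <= r ->
  \sum_i `|2 * d i * w i| <= L -> (0 < q)%N -> 0 < M -> 0 < y ->
  (L + M) * r + y <= x ->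
  (uniform_prob TT (big_increment (cos_sum b d w) r x)
   <= (M * (M^-1) ^+ (2 * q) / y
       * (2 * r * ((q`!%:R + 2) * (\sum_i (b i * w i) ^+ 2) ^+ q)))%:E)%E.
Proof.
move=> w p_inj p_pr b_ge0 Y_gt0 le_pY le_IY le_YT r_ge0 le_L q_gt0 M_gt0 y_gt0.
move=> le_x.
have T_gt0 : 0 < T by lra.
pose a i := b i * w i; pose c := M * (M^-1) ^+ (2 * q) / y.
have a_ge0 i : 0 <= a i.
  by rewrite mulr_ge0 // ln_ge0 // ler1n prime_gt0.
have c_ge0 : 0 <= c.
  by rewrite divr_ge0 ?mulr_ge0 ?exprn_ge0 ?invr_ge0 ?(ltW M_gt0) ?(ltW y_gt0).
pose W := word_window_antiderivative a w q r.
have dW (v : R) : is_derive v 1 (c \*: W) (c * word_window a w q r v).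
  have dW2 := is_derive_word_window_antiderivative a w q r v.
  exact: is_deriveZ.
have window_cont : continuous (fun v => c * word_window a w q r v).
  have dB := is_derive_word_primitive a w q.
  have B_cont := continuous_is_derive dB.
  set B := word_primitive a w q in B_cont.
  have -> : (fun v => c * word_window a w q r v)
    = (fun v => c * (B (v + r) - B (v - r))).
    by apply/funext => v; rewrite word_window_primitive.
  move=> v; apply: cvgM; first exact: cvg_cst.
  apply: cvgB; apply: (@continuous_comp _ _ _ (fun s => s + _) B);
    try exact: B_cont; by apply: cvgD; [exact: cvg_id | exact: cvg_cst].
have mU : measurable (big_increment (cos_sum b d w) r x).
  apply: open_measurable; apply: open_big_increment.
  exact: continuous_cos_sum.
apply: le_trans (uniform_prob_le_primitive TT mU window_cont _ dW _) _.
- by move=> v; rewrite mulr_ge0 // word_window_ge0.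
- move=> s [h le_hr lt_x].
  have := cos_sum_increment_le b s q_gt0 M_gt0 le_L le_hr.
  rewrite -/a /c => le_incr.
  by rewrite mulrAC ler_pdivlMr // mul1r; lra.
rewrite lee_fin [_ \*: _]/= -[_ - T]/(2 * T - T).
have -> : 2 * T - T = T by lra.
rewrite -mulrBr -[leLHS]mulrA -/c ler_wpM2l // ler_pdivrMr //.
have := word_window_mean_value p_inj p_pr a_ge0 Y_gt0 le_pY le_IY
  (ltW T_gt0) le_YT r_ge0.
move=> /le_trans; apply; rewrite -/a; by lra.
Qed.

(** * The prime sums *)

Lemma inv_cexp (R : realType) (z : R[i]) : (cexp z)^-1 = cexp (- z).
Proof.
apply: mulr1_eq; case: z => u v; rewrite /cexp /=.
have expM : expR u * expR (- u) = 1 by rewrite expRxMexpNx_1.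
have trig := cos2Dsin2 v.
apply/eqP; rewrite eq_complex /= cosN sinN; apply/andP; split; apply/eqP.
  transitivity ((expR u * expR (- u)) * (cos v ^+ 2 + sin v ^+ 2)).
    by ring.
  by rewrite expM trig mulr1.
by ring.
Qed.

Lemma prime_term_cos (R : realType) (p : nat) (y : R) :
  prime_term p y
  = expR (- (ln p%:R / 2)) * cos (ln p%:R * y)
    + expR (- ln p%:R) / 2 * cos (2 * ln p%:R * y).
Proof.
have half (z : R[i]) : complex.Re (2^-1 * z) = 2^-1 * complex.Re z.
  have -> : (2^-1 : R[i]) = (2^-1 : R)%:C%C by rewrite fmorphV rmorph_nat.
  by case: z => u v /=; rewrite mul0r subr0.
rewrite /prime_term /natcpow !inv_cexp.
have ReD (z z' : R[i]) : complex.Re (z + z') = complex.Re z + complex.Re z'.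
  by case: z; case: z'.
rewrite ReD half /cexp /=; congr (_ + _).
  rewrite !mulr0 !mul0r !subr0 add0r cosN; congr (expR (- _) * cos _); ring.
rewrite !mulr0 !mul0r !subr0 add0r cosN mul1r mulrA [2^-1 * _]mulrC.
by congr (_ * cos _); ring.
Qed.

Lemma max_increment_gt (R : realType) (tau k r x : R) (G : R -> R) :
  (forall h, prime_sum tau k h = G (tau + h)) ->
  (x%:E < max_increment tau k r)%E <-> big_increment G r x tau.
Proof.
move=> sumE; rewrite /max_increment; split.
  move=> /ereal_sup_gt[_ [h /= le_hr <-]].
  by rewrite lte_fin !sumE addr0 => lt_x; exists h.
move=> [h le_hr lt_x].
apply: (@lt_le_trans _ _ `|prime_sum tau k h - prime_sum tau k 0|%:E).
  by rewrite lte_fin !sumE addr0.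
by apply: ereal_sup_ubound; exists h.
Qed.

Definition primes_upto (R : realType) (k : R) : seq nat :=
  [seq p <- index_iota 0 (Num.truncn (expR (expR k))).+1
  | [&& prime p, expR (expR 1000) < p%:R :> R & p%:R <= expR (expR k)]].

Lemma mem_primes_upto (R : realType) (k : R) (p : nat) :
  p \in primes_upto k -> prime p /\ p%:R <= expR (expR k).
Proof. by rewrite mem_filter => /andP[/and3P[]]. Qed.

Lemma sum_primes_upto_le (R : realType) (k : R) (F : nat -> R) :
  (forall p, prime p -> 0 <= F p) ->
  \sum_(p <- primes_upto k) F p
  <= \sum_(p <- [seq p <- index_iota 0 (Num.truncn (expR (expR k))).+1
                | prime p]) F p.
Proof.
move=> F_ge0; rewrite !big_filter big_mkcond [leRHS]big_mkcond.
apply: ler_sum => p _; case: (boolP (prime p)) => //= p_pr.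
by case: ifP => // _; exact: F_ge0.
Qed.

Lemma size_primes_upto_le (R : realType) (k : R) :
  (size (primes_upto k))%:R <= expR (expR k).
Proof.
apply: le_trans (_ : (Num.truncn (expR (expR k)))%:R <= _); last first.
  by rewrite truncn_le expR_ge0.
rewrite ler_nat -sum1_size big_filter.
(* [0] is not prime, so that only [truncn] candidates remain *)
rewrite big_ltn_cond //=.
apply: leq_trans (_ : \sum_(1 <= i < (Num.truncn (expR (expR k))).+1) 1 <= _)%N.
  rewrite [leqRHS](bigID (fun p => [&& prime p, expR (expR 1000) < p%:R :> R
    & p%:R <= expR (expR k)])).
  exact: leq_addr.
by rewrite sum_nat_const_nat muln1 subn1.
Qed.

Lemma sum_ln_primes_upto_le (R : realType) (k : R) :
  0 <= k -> \sum_(p <- primes_upto k) ln (p%:R : R) / p%:R <= 2 * expR k.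
Proof.
move=> k_ge0.
have Y_ge1 : 1 <= expR (expR k) by rewrite -[leLHS]expR0 ler_expR expR_ge0.
have n_gt0 : (0 < Num.truncn (expR (expR k)))%N by rewrite truncn_gt0.
apply: le_trans (sum_primes_upto_le k _) _ => [p p_pr|].
  by rewrite divr_ge0 // ln_ge0 // ler1n prime_gt0.
apply: le_trans (sum_ln_prime_div R n_gt0) _; rewrite ler_wpM2l //.
rewrite -[leRHS]expRK ler_ln ?posrE ?ltr0n ?expR_gt0 //.
by rewrite truncn_le expR_ge0.
Qed.

Lemma sum_ln2_primes_upto_le (R : realType) (k : R) :
  0 <= k ->
  \sum_(p <- primes_upto k) ln (p%:R : R) ^+ 2 / p%:R <= 2 * expR k ^+ 2.
Proof.
move=> k_ge0.
apply: le_trans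
  (_ : \sum_(p <- primes_upto k) expR k * (ln (p%:R : R) / p%:R) <= _).
  rewrite big_seq [leRHS]big_seq.
  apply: ler_sum => p /mem_primes_upto[p_pr le_pY].
  have p_gt0 : (0 : R) < p%:R by rewrite ltr0n prime_gt0.
  rewrite expr2 -mulrA ler_wpM2r ?divr_ge0 ?ln_ge0 ?ler1n ?prime_gt0 //.
  by rewrite -[leRHS]expRK ler_ln ?posrE ?expR_gt0.
rewrite -mulr_sumr expr2 mulrCA ler_wpM2l ?expR_ge0 //.
exact: sum_ln_primes_upto_le.
Qed.

(** * Choice of the moment and conclusion *)

Lemma prime_sum_cos_sum (R : realType) (k tau h : R) :
  let ps := in_tuple (primes_upto k) in
  let w (i : 'I_(size (primes_upto k))) : R := ln (tnth ps i)%:R in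
  prime_sum tau k h
  = cos_sum (fun i => expR (- (w i / 2))) (fun i => expR (- w i) / 2) w
      (tau + h).
Proof.
move=> ps w; rewrite /prime_sum -big_filter -/(primes_upto k) big_tnth.
by apply: eq_bigr => i _; rewrite prime_term_cos.
Qed.

Lemma expR1_le4 (R : realType) : expR 1 <= 4 :> R.
Proof.
have half : expR (2^-1) <= 2 :> R.
  have := expR_ge1Dx (- 2^-1 : R); rewrite expRN => ge.
  have e_gt0 : 0 < expR (2^-1 : R) by exact: expR_gt0.
  have : expR (2^-1 : R) * (1 - 2^-1) <= 1.
    by rewrite -[leRHS](divff (lt0r_neq0 e_gt0)) ler_wpM2l // ltW.
  lra.
have -> : expR 1 = expR 2^-1 * expR 2^-1 :> R.
  by rewrite -expRD; congr expR; lra.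
have := expR_ge0 (2^-1 : R); nra.
Qed.

(** With [M = x / (4 r)], the truncation level [M] and the squares of the
    primes use up at most [x / 4] each, as [r * 2 e^k = 4 <= x / 4]; half of [x]
    is left to the moment.  Then [(V / M^2)^q = (16 r^2 V / x^2)^q] with
    [r^2 V <= 8]. *)
Lemma prime_increment_moment (R : realType) (k x T : R) (q : nat)
    (TT : T < 2 * T) :
  let ps := in_tuple (primes_upto k) in
  let w (i : 'I_(size (primes_upto k))) : R := ln (tnth ps i)%:R in
  0 <= k -> 16 <= x -> (0 < q)%N -> 512 * q%:R <= x ^+ 2 ->
  expR (expR k) ^+ (2 * q) <= T ->
  (uniform_prob TT (big_increment
      (cos_sum (fun i => expR (- (w i / 2))) (fun i => expR (- w i) / 2) w)
      (2 * expR (- k)) x)%R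
   <= (3 * expR (- q%:R))%:E)%E.
Proof.
move=> ps w k_ge0 x_ge16 q_gt0 le_qx le_YT.
set Y := expR (expR k); set r := 2 * expR (- k).
have ek_gt0 : 0 < expR k by exact: expR_gt0.
have r_gt0 : 0 < r by rewrite mulr_gt0 // expR_gt0.
have rk : r * expR k = 2.
  by rewrite /r -mulrA [_ * expR k]mulrC expRxMexpNx_1 mulr1.
have mem_ps i : tnth ps i \in primes_upto k by exact: mem_tnth.
have p_pr i : prime (tnth ps i) by have [] := mem_primes_upto (mem_ps i).
have le_pY i : (tnth ps i)%:R <= Y by have [] := mem_primes_upto (mem_ps i).
have p_gt0 i : (0 : R) < (tnth ps i)%:R by rewrite ltr0n prime_gt0.
have p_inj : injective (tnth ps).
  apply/tuple_uniqP; exact: filter_uniq (iota_uniq _ _).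
have w_ge0 i : 0 <= w i by rewrite ln_ge0 // ler1n prime_gt0.
have expNw i : expR (- w i) = (tnth ps i)%:R^-1 by rewrite expRN lnK // posrE.
have le_L : \sum_i `|2 * (expR (- w i) / 2) * w i| <= 2 * expR k.
  apply: le_trans (sum_ln_primes_upto_le k_ge0); rewrite [leRHS]big_tnth.
  apply: ler_sum => i _; rewrite ger0_norm; last first.
    by rewrite !mulr_ge0 ?invr_ge0 ?expR_ge0.
  by rewrite mulrCA divff // mulr1 expNw mulrC.
have le_V : \sum_i (expR (- (w i / 2)) * w i) ^+ 2 <= 2 * expR k ^+ 2.
  apply: le_trans (sum_ln2_primes_upto_le k_ge0); rewrite [leRHS]big_tnth.
  apply: ler_sum => i _; rewrite exprMn expr2 -expRD.
  have -> : - (w i / 2) + - (w i / 2) = - w i by lra.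
  by rewrite expNw mulrC.
set V := \sum_i _ in le_V.
have V_ge0 : 0 <= V by apply: sumr_ge0 => i _; exact: sqr_ge0.
have card_le : #|'I_(size (primes_upto k))|%:R <= Y.
  by rewrite card_ord size_primes_upto_le.
pose M := x / (4 * r); pose y := x / 2.
have x_gt0 : 0 < x by lra.
have M_gt0 : 0 < M by rewrite divr_gt0 // mulr_gt0.
have y_gt0 : 0 < y by rewrite divr_gt0.
have Mr : M * r = x / 4 by rewrite /M; field; rewrite lt0r_neq0.
have le_x : (2 * expR k + M) * r + y <= x.
  by rewrite mulrDl Mr -mulrA [_ * r]mulrC rk /y; lra.
apply: le_trans (uniform_prob_big_increment TT p_inj p_pr
  (fun i => expR_ge0 _) (expR_gt0 _) le_pY card_le le_YT (ltW r_gt0)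
  le_L q_gt0 M_gt0 y_gt0 le_x) _.
rewrite lee_fin -/V.
have -> : M * M^-1 ^+ (2 * q) / y * (2 * r * ((q`!%:R + 2) * V ^+ q))
    = (M * r * (2 / y)) * ((q`!%:R + 2) * (M^-1 ^+ 2 * V) ^+ q).
  by rewrite exprMn -exprM; field; rewrite lt0r_neq0 // lt0r_neq0.
have -> : M * r * (2 / y) = 1 by rewrite Mr /y; field; rewrite lt0r_neq0.
rewrite mul1r.
have fact_le : q`!%:R + 2 <= 3 * q%:R ^+ q :> R.
  have : q`!%:R <= q%:R ^+ q :> R by rewrite -natrX ler_nat fact_leq_expn.
  have : 1 <= q`!%:R :> R by rewrite ler1n fact_gt0.
  lra.
have base_le : q%:R * (M^-1 ^+ 2 * V) <= 4^-1.
  have -> : M^-1 ^+ 2 = 16 * r ^+ 2 / x ^+ 2.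
    by rewrite /M; field; rewrite !lt0r_neq0.
  have rV : r ^+ 2 * V <= 8.
    apply: le_trans (ler_wpM2l (sqr_ge0 r) le_V) _.
    by rewrite mulrCA -exprMn rk; lra.
  have -> : q%:R * (16 * r ^+ 2 / x ^+ 2 * V)
      = 16 * q%:R * (r ^+ 2 * V) / x ^+ 2 by ring.
  rewrite ler_pdivrMr ?exprn_gt0 //.
  have : q%:R * (r ^+ 2 * V) <= q%:R * 8 by rewrite ler_wpM2l.
  lra.
have expN1 : 4^-1 <= expR (- 1) :> R.
  by rewrite expRN lef_pV2 ?posrE ?expR_gt0 // expR1_le4.
have pow_le : (q%:R * (M^-1 ^+ 2 * V)) ^+ q <= expR (- q%:R).
  have -> : - q%:R = q%:R * - 1 :> R by rewrite mulrN1.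
  rewrite expRM_natl lerXn2r ?nnegrE ?expR_ge0 ?(le_trans base_le) //.
  by rewrite !mulr_ge0 ?exprn_ge0 ?invr_ge0 ?(ltW M_gt0).
apply: le_trans (_ : 3 * q%:R ^+ q * (M^-1 ^+ 2 * V) ^+ q <= _).
  rewrite ler_wpM2r // exprn_ge0 // mulr_ge0 //.
  by rewrite exprn_ge0 // invr_ge0 ltW.
by rewrite -mulrA -exprMn ler_wpM2l.
Qed.

Theorem proposition1p5 (R : realType) :
  exists c C : R, 0 < c /\ 0 < C /\
  forall (theta T t ttheta x : R),
    -1 < theta <= 0 ->
    expR 1 < T ->
    t = ln (ln T) ->
    ttheta = `|theta| * t ->
    2 < x < expR (t * (1 + theta) / 2) ->
  forall (d : measure_display) (Omega : measurableType d)
    (P : probability Omega R) (tau : {RV P >-> R}),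
    uniform_on tau T (2 * T) ->
    (P [set omega | (x%:E < max_increment (tau omega) ttheta
                              (2 * expR (theta * t)))%E]
     <= (C * expR (- (x ^+ 2 / c)))%:E)%E.
Proof.
(* The factor [expR 1] pays for the integer part in [q]; it also makes the
   bound trivial when [q = 0]. *)
exists 512, (3 * expR 1); split; first by rewrite ltr0n.
split; first by rewrite mulr_gt0 // expR_gt0.
move=> theta T t k x /andP[theta_gtN1 theta_le0] T_gt_e tE kE /andP[x_gt2 x_lt].
move=> d Omega P tau [ab tau_unif].
have T_gt0 : 0 < T by apply: lt_trans T_gt_e; exact: expR_gt0.
have lnT_gt1 : 1 < ln T by rewrite -[ltLHS]expRK ltr_ln ?posrE ?expR_gt0.
have t_gt0 : 0 < t by rewrite tE ln_gt0.
have {}kE : k = - (theta * t) by rewrite kE ler0_norm // mulNr.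
have k_ge0 : 0 <= k by rewrite kE oppr_ge0 mulr_le0_ge0 // ltW.
have -> : theta * t = - k by rewrite kE opprK.
have TE : T = expR (expR t) by rewrite tE !lnK // posrE // (lt_trans ltr01).
have x_gt0 : 0 < x by lra.
have x2_lt : x ^+ 2 < expR (t - k).
  have -> : t - k = t * (1 + theta) / 2 + t * (1 + theta) / 2.
    by rewrite kE; field.
  by rewrite expRD -expr2 ltrXn2r // ltW.
pose q := Num.truncn (x ^+ 2 / 512).
have /andP[q_le q_gt] : q%:R <= x ^+ 2 / 512 < q.+1%:R.
  by apply: truncn_itv; rewrite divr_ge0 ?sqr_ge0 ?ler0n.
have bound_q : 3 * expR (- q%:R) <= 3 * expR 1 * expR (- (x ^+ 2 / 512)) :> R.
  rewrite -mulrA ler_wpM2l // -expRD ler_expR.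
  by move: q_gt; rewrite -natr1; lra.
pose w (i : 'I_(size (primes_upto k))) : R :=
  ln (tnth (in_tuple (primes_upto k)) i)%:R.
pose G := cos_sum (fun i => expR (- (w i / 2))) (fun i => expR (- w i) / 2) w.
set E := [set _ | _].
have -> : E = tau @^-1` (big_increment G (2 * expR (- k)) x).
  apply/seteqP; split=> omega; apply max_increment_gt => h;
    exact: prime_sum_cos_sum.
have mU : measurable (big_increment G (2 * expR (- k)) x).
  apply: open_measurable; apply: open_big_increment.
  exact: continuous_cos_sum.
have := tau_unif _ mU; rewrite /distribution /pushforward => ->.
apply: le_trans (_ : (3 * expR (- q%:R))%:E <= _)%E; last by rewrite lee_fin.
have [q0|q_gt0] := posnP q.
  apply: le_trans (probability_le1 (uniform_prob ab) mU) _.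
  by rewrite q0 lee_fin oppr0 expR0; lra.
have x_ge16 : 16 <= x.
  have : 1 <= q%:R :> R by rewrite ler1n.
  by nra.
apply: prime_increment_moment => //.
  by move: q_le; rewrite ler_pdivlMr ?ltr0n // mulrC.
have ek_gt0 : 0 < expR k by exact: expR_gt0.
rewrite TE -expRM_natl ler_expR natrM -[t](subrK k) expRD.
rewrite ler_wpM2r ?(ltW ek_gt0) //; apply: le_trans (ltW x2_lt).
by have := sqr_ge0 x; lra.
Qed.
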